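(* The set of all possible cardinalities $|A^*|$, where $A$ ranges over all rings with finite group of units, has density equal to $\frac12$.
   Context: Rings are commutative with $1\neq 0$. $A^*$ denotes the multiplicative group of invertible elements of $A$. For $X\subset\mathbb{N}$ and $n\in\mathbb N$ put $X(n):=X\cap\{1,\dots,n\}$; the density of $X$ is $\lim_{n\to\infty}\frac{|X(n)|}{n}$, whenever this limit exists (the claim includes its existence). *)

(* Defs.v *)
From mathcomp Require Import all_boot all_order all_algebra.
From mathcomp Require Import finmap.
From mathcomp Require Import all_classical all_reals all_analysis.

Set Implicit Arguments.
Unset Strict Implicit.
Unset Printing Implicit Defensive.

Import Order.TTheory GRing.Theory Num.Theory numFieldNormedType.Exports.

Local Open Scope classical_set_scope.
Local Open Scope card_scope.
Local Open Scope ring_scope.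

(* A comNzRingType is an arbitrary commutative ring with 1 != 0. The library's
   GRing.unit is only available on rings that come with a boolean unit
   predicate (comUnitRingType), hence this definition; it coincides with
   GRing.unit on such rings. *)
Definition units (A : comNzRingType) : set A :=
  [set x | exists y : A, x * y = 1].
Arguments units A : clear implicits.

(* The equipotence with `I_n = {0, ..., n-1} includes the finiteness of A^*. *)
Definition unit_group_orders : set nat :=
  [set n | exists A : comNzRingType, units A #= `I_n].

Definition initial_part (X : set nat) (n : nat) : set nat :=
  X `&` [set k | (1 <= k <= n)%N].

(* fset_set sends a finite set (as initial_part X n always is) to the
   corresponding element of {fset nat}. The value at n = 0 is the junk 0 / 0
   and is irrelevant for the limit. *)
Definition has_density (R : realType) (X : set nat) (d : R) : Prop :=
  (#|` fset_set (initial_part X n)|%:R / n%:R : R) @[n --> \oo] --> d.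

(* Main.v *)
Require Import Defs.
From HB Require Import structures.
From mathcomp Require Import all_boot all_order all_algebra finmap.
From mathcomp Require Import all_classical all_reals all_analysis.
From mathcomp Require Import lra zify.

(** Every even number [2 m > 0] is the number of units of some ring: the trivial
    extension of the integers by the group of integers modulo [m], with that
    group an ideal of square zero, has as its units the pairs [(1, u)] and
    [(-1, u)] ([even_unit_group_order]).

    Odd numbers contribute density zero. If the unit group has odd order, it
    has no element of order 2, so [-1 = 1], and [1 + x] is a unit of order at
    most 2, hence equal to 1, as soon as [x * x = 0]. Thus the ring is reduced of
    characteristic 2, and so is the additive span of its units, which is a
    finite ring with the same units. Such a ring is a product of finite fields,
    hence the number of units is a product of numbers [2 ^ k - 1]
    ([odd_unit_group_order]). The decomposition into fields is obtained by
    repeated splitting along idempotents, inside the given ring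
    ([card_invertibles]).

    Finally, products of numbers [2 ^ k - 1] with [2 <= k] are rare: at most
    [3 ^ (L + 1)] of them lie below [4 ^ L] ([size_mersenne_products_below],
    [mem_mersenne_products_below]). Indeed, for every [j > 0] only two of the
    factors, those with [k = 2 j + 1] and [k = 2 j + 2], have a size between
    [4 ^ j] and [4 ^ (j + 1)]; so the number [g L] of products below [4 ^ L]
    without the factor 3 satisfies [g L <= 1 + 2 (g 0 + ... + g (L - 1))], whence
    [g L <= 3 ^ L]. Up to [n], the even numbers together with these products give
    a proportion that differs from [1 / 2] by at most [9 (3 / 4) ^ l], where
    [4 ^ l <= n < 4 ^ (l + 1)] ([half_dist_bound]). *)

Set Implicit Arguments.
Unset Strict Implicit.
Unset Printing Implicit Defensive.

Import Order.TTheory GRing.Theory Num.Theory numFieldNormedType.Exports.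

(** * Products of numbers of the form 2 ^ k - 1 *)

Section MersenneProducts.
Local Open Scope nat_scope.

(** The exponents are allowed to repeat; [k0] bounds them from below, so that
    [mersenne_product 2] excludes only the trivial factor [2 ^ 1 - 1] and
    [mersenne_product 3] also the factor 3. *)
Inductive mersenne_product (k0 : nat) : nat -> Prop :=
| mersenne_product1 : mersenne_product k0 1
| mersenne_productM k m : k0 <= k -> mersenne_product k0 m ->
    mersenne_product k0 ((2 ^ k - 1) * m).

Lemma mersenne_product_mul k0 m n :
  mersenne_product k0 m -> mersenne_product k0 n ->
  mersenne_product k0 (m * n).
Proof.
move=> + Pn; elim=> [|k l k_ge _ IHl]; first by rewrite mul1n.
by rewrite -mulnA; apply: mersenne_productM.
Qed.

Lemma mersenne_product_gt0 k0 m : 0 < k0 -> mersenne_product k0 m -> 0 < m.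
Proof.
move=> k0_gt0; elim=> // k l k_ge _ l_gt0.
by rewrite muln_gt0 l_gt0 subn_gt0 -{1}(expn0 2) ltn_exp2l // (leq_trans k0_gt0).
Qed.

(** The factor 3 is the only one below 4, and it has to be counted apart: all
    the other factors lose at least one power of 4. *)
Lemma mersenne_product2E m : mersenne_product 2 m ->
  exists a m', mersenne_product 3 m' /\ m = 3 ^ a * m'.
Proof.
elim=> [|k l + _ [a [m' [Pm' ->]]]]; first by exists 0, 1; split=> //; left.
rewrite leq_eqVlt => /predU1P[<-|k_gt2].
  exists a.+1, m'; split=> //.
  by rewrite [3 ^ a.+1]expnS mulnA.
exists a, ((2 ^ k - 1) * m'); split; first by right.
by rewrite mulnCA.
Qed.

(** A pair [(j, x)] stands for the two numbers obtained from [x] by multiplying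
    with a factor [2 ^ k - 1] such that [k.-1./2 = j], namely [k = 2j + 1] and
    [k = 2j + 2]. Both factors are at least [4 ^ j]. The leading 1 is the
    empty product. *)
Definition from_pairs (t : seq (nat * nat)) : seq nat :=
  1 :: [seq (2 ^ p.1.*2.+1 - 1) * p.2 | p <- t]
    ++ [seq (2 ^ p.1.*2.+2 - 1) * p.2 | p <- t].

(** The pairs [(j, x)] with [0 < j], [x] a product of factors other than 3 and
    [4 ^ j * x < 4 ^ L]: either [j = 1] and [x < 4 ^ (L - 1)], or [j] can be
    lowered together with [L]. *)
Fixpoint pairs (L : nat) : seq (nat * nat) :=
  if L is L'.+1 then
    [seq (1, x) | x <- from_pairs (pairs L')] ++ [seq (p.1.+1, p.2) | p <- pairs L']
  else [::].

Lemma size_from_pairs t : size (from_pairs t) = (size t).*2.+1.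
Proof. by rewrite /= size_cat !size_map addnn. Qed.

(** If [t] is the number of pairs, then there are [2 t + 1] listed products, and
    passing from [L] to [L + 1] turns [t] into [(2 t + 1) + t = 3 t + 1]. *)
Lemma size_pairs L : size (from_pairs (pairs L)) = 3 ^ L.
Proof.
elim: L => // L; rewrite !size_from_pairs size_cat !size_map size_from_pairs.
by rewrite expnS -/pairs; lia.
Qed.

Lemma pow4_le_mersenne j b : 4 ^ j <= 2 ^ (j.*2.+1 + b) - 1.
Proof.
have -> : 4 ^ j = 2 ^ j.*2 by rewrite -mul2n expnM.
have h1 : 2 ^ (j.*2.+1) <= 2 ^ (j.*2.+1 + b) by rewrite leq_pexp2l // leq_addr.
have := expnS 2 j.*2; have : 0 < 2 ^ j.*2 by rewrite expn_gt0.
lia.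
Qed.

Lemma pairsP L :
  (forall m, mersenne_product 3 m -> m < 4 ^ L -> m \in from_pairs (pairs L)) /\
  (forall j x, 0 < j -> mersenne_product 3 x -> 4 ^ j * x < 4 ^ L ->
     (j, x) \in pairs L).
Proof.
have from_pairsP l :
    (forall j x, 0 < j -> mersenne_product 3 x -> 4 ^ j * x < 4 ^ l ->
      (j, x) \in pairs l) ->
    forall m, mersenne_product 3 m -> m < 4 ^ l -> m \in from_pairs (pairs l).
  move=> pairsP m [|k x k_ge Px ltm]; first by rewrite inE eqxx.
  (* Here [2 ^ k - 1] is the smaller or the larger factor attached to [j]. *)
  pose j := k.-1./2; pose b := k - j.*2.+1.
  have [j_gt0 b_le1 kE] : [/\ 0 < j, b <= 1 & k = j.*2.+1 + b].
    by rewrite /b /j; split; lia.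
  have jx : (j, x) \in pairs l.
    apply: pairsP => //; apply: leq_ltn_trans ltm.
    by rewrite leq_mul2r kE pow4_le_mersenne orbT.
  have {b_le1} [b0|b1] : b = 0 \/ b = 1 by lia.
    rewrite inE mem_cat; apply/orP; right; apply/orP; left.
    by apply/mapP; exists (j, x) => //=; rewrite kE b0 addn0.
  rewrite inE mem_cat; apply/orP; right; apply/orP; right.
  by apply/mapP; exists (j, x) => //=; rewrite kE b1 addn1.
suff pairsP : forall j x, 0 < j -> mersenne_product 3 x -> 4 ^ j * x < 4 ^ L ->
     (j, x) \in pairs L by split=> //; exact: from_pairsP.
elim: L => [|L IHL] j x j_gt0 Px ltx.
  have : 0 < x by exact: mersenne_product_gt0 Px.
  have : 0 < 4 ^ j by rewrite expn_gt0.
  by move: ltx; rewrite expn0; nia.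
case: j j_gt0 ltx => // -[|j] _ ltx.
  rewrite mem_cat; apply/orP; left; apply/mapP; exists x => //.
  by apply: from_pairsP => //; move: ltx; rewrite expn1 expnS ltn_mul2l.
rewrite mem_cat; apply/orP; right; apply/mapP; exists (j.+1, x) => //.
by apply: IHL => //; move: ltx; rewrite [4 ^ j.+2]expnS [4 ^ L.+1]expnS -mulnA ltn_mul2l.
Qed.

(** A product with the factor 3 occurring [a] times is covered according to
    [a = 0], [a = 1] or [a >= 2]; in the last case division by 9 lowers it below
    the previous power of 4. *)
Fixpoint mersenne_products_below (L : nat) : seq nat :=
  if L is L'.+1 then
    from_pairs (pairs L) ++ [seq 3 * x | x <- from_pairs (pairs L)]
      ++ [seq 9 * x | x <- mersenne_products_below L']
  else [::].

Lemma size_mersenne_products_below L :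
  size (mersenne_products_below L) <= 3 ^ L.+1.
Proof.
elim: L => // L IHL; rewrite 2!size_cat 2!size_map size_pairs -/mersenne_products_below.
by move: IHL; rewrite !expnS; lia.
Qed.

Lemma mem_mersenne_products_below L m :
  mersenne_product 2 m -> m < 4 ^ L -> m \in mersenne_products_below L.
Proof.
move=> /mersenne_product2E[a [x [Px ->]]].
have x_gt0 : 0 < x by exact: mersenne_product_gt0 Px.
elim: L a => [|L IHL] a lta.
  have : 0 < 3 ^ a by rewrite expn_gt0.
  by move: lta; rewrite expn0; nia.
have [inP _] := pairsP L.+1.
rewrite 2!mem_cat -/mersenne_products_below; case: a lta => [|[|a]] lta.
- by move: lta; rewrite expn0 mul1n => ltx; rewrite inP.
- apply/orP; right; apply/orP; left; apply/mapP; exists x => //.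
  by apply: inP => //; move: lta; rewrite expn1; lia.
apply/orP; right; apply/orP; right; apply/mapP; exists (3 ^ a * x).
  by apply: IHL; move: lta; rewrite !expnS; lia.
by rewrite !expnS; lia.
Qed.

End MersenneProducts.

Local Open Scope ring_scope.

(** * Rings with an even number of units *)

(** The ring obtained from the integers by adjoining the abelian group [M] as an
    ideal of square zero. *)
Definition int_trivial_extension (M : zmodType) : Type := (int * M)%type.

Section IntTrivialExtension.
Variable M : zmodType.
Local Notation T := (int_trivial_extension M).
HB.instance Definition _ := GRing.Zmodule.copy T (int * M)%type.

Definition ite_one : T := (1, 0).
Definition ite_mul (x y : T) : T := (x.1 * y.1, y.2 *~ x.1 + x.2 *~ y.1).

Lemma ite_mulA : associative ite_mul.
Proof.
move=> [a u] [b v] [c w]; rewrite /ite_mul /= mulrA; congr (_, _).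
by rewrite !mulrzDl -!mulrzA addrA [b * a]mulrC [c * a]mulrC.
Qed.

Lemma ite_mulC : commutative ite_mul.
Proof. by move=> [a u] [b v]; rewrite /ite_mul /= mulrC addrC. Qed.

Lemma ite_mul1 : left_id ite_one ite_mul.
Proof. by move=> [a u]; rewrite /ite_mul /= mul1r mul0rz addr0. Qed.

Lemma ite_mulDl : left_distributive ite_mul +%R.
Proof.
move=> [a u] [b v] [c w]; rewrite /ite_mul /= mulrDl; congr (_, _).
by rewrite mulrzDr mulrzDl addrACA.
Qed.

Lemma ite_one_neq0 : ite_one != 0.
Proof. by []. Qed.

HB.instance Definition _ := GRing.Zmodule_isComNzRing.Build T
  ite_mulA ite_mulC ite_mul1 ite_mulDl ite_one_neq0.
End IntTrivialExtension.

Lemma units_trivial_extension (M : zmodType) :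
  units (int_trivial_extension M) =
  range (fun p : bool * M => ((-1) ^+ p.1, p.2) : int_trivial_extension M).
Proof.
apply/seteqP; split=> [[a u] [[b v] [ab1 _]]|_ [[s u] _ <-]] /=.
  have : a \is a GRing.unit by apply/unitrPr; exists b.
  move=> /orP[/eqP ->|/eqP ->]; first by exists (false, u).
  by exists (true, u).
exists ((-1) ^+ s, - u); congr (_, _); first by rewrite -expr2 sqrr_sign.
by rewrite /= mulNrz addNr.
Qed.

(** The trivial extension by the integers modulo [m] has [2 m] units. *)
Lemma even_unit_group_order n : (0 < n)%N -> ~~ odd n -> unit_group_orders n.
Proof.
move=> n_gt0 n_even; pose m := n./2.-1.
have nE : n = (2 * m.+1)%N by rewrite /m; lia.
exists (int_trivial_extension 'I_m.+1); rewrite units_trivial_extension.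
apply: (@card_eq_trans _ _ _ _ [set: bool * 'I_m.+1]).
  by apply: inj_card_eq => -[[] u] [[] v] _ _ // [->].
have -> : [set: bool * 'I_m.+1]%classic = range (@enum_val (bool * 'I_m.+1)%type predT).
  by apply/seteqP; split=> // p _; exists (enum_rank p); rewrite ?enum_rankK.
apply: (@card_eq_trans _ _ _ _ [set: 'I_#|{: bool * 'I_m.+1}|]).
  by apply: inj_card_eq => i j _ _; apply: enum_val_inj.
have -> : n = #|{: bool * 'I_m.+1}| by rewrite card_prod card_bool card_ord.
by rewrite card_eq_sym; exact: card_II.
Qed.

(** * Rings with an odd number of units *)

(** Lagrange's theorem for an abelian group: multiplication by [u] permutes the
    units, so it does not change their product. *)
Lemma unit_expr_card (A : comNzRingType) (n : nat) (u : A) :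
  (units A #= `I_n)%card -> units A u -> u ^+ n = 1.
Proof.
move=> Un [v uv].
have Ufin : finite_set (units A) by apply/finite_setP; exists n.
pose U := fset_set (units A).
have UP x : (x \in U) = `[< units A x >] by rewrite in_fset_set.
have units_mul x y : units A x -> units A y -> units A (x * y).
  by move=> [x' xx'] [y' yy']; exists (x' * y'); rewrite mulrACA xx' yy' mulr1.
have uU : units A u by exists v.
have vU : units A v by exists u; rewrite mulrC.
have prodU : units A (\prod_(x <- U) x).
  rewrite big_seq; elim/big_rec: _ => [|x y]; first by exists 1; rewrite mulr1.
  by rewrite UP => /asboolP; exact: units_mul.
have perm_uU : perm_eq [seq u * x | x <- U] U.
  apply: uniq_perm; rewrite ?fset_uniq //.
    rewrite map_inj_uniq ?fset_uniq // => x y uxy.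
    by rewrite -[x]mul1r -[y]mul1r -uv [u * v]mulrC -!mulrA uxy.
  move=> x; rewrite UP; apply/mapP/asboolP => [[y + ->]|xU].
    by rewrite UP => /asboolP; exact: units_mul.
  exists (v * x); last by rewrite mulrA uv mul1r.
  by rewrite UP; apply/asboolP; exact: units_mul.
have := perm_big _ perm_uU : \prod_(x <- [seq u * x | x <- U]) x = \prod_(x <- U) x.
rewrite big_map big_split /= big_const_seq count_predT iter_mulr_1.
rewrite (card_fset_set Un).
by case: prodU => w Pw /(congr1 ( *%R^~ w)); rewrite -mulrA Pw mulr1.
Qed.

Lemma odd_expr_sqr1 (A : pzRingType) (n : nat) (u : A) :
  odd n -> u ^+ n = 1 -> u ^+ 2 = 1 -> u = 1.
Proof.
move=> n_odd + u2; rewrite -(odd_double_half n) n_odd -muln2 mulnC exprS exprM u2.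
by rewrite expr1n mulr1.
Qed.

Section FiniteSubring.
Local Open Scope fset_scope.
Local Open Scope ring_scope.
Variable A : comPzRingType.
Hypothesis char2 : forall x : A, x + x = 0.

Lemma char2_cancel (x y : A) : x + (x + y) = y.
Proof. by rewrite addrA char2 add0r. Qed.

Definition add_closed (E : {fset A}) := {in E &, forall x y, x + y \in E}.
Definition mul_closed (E : {fset A}) := {in E &, forall x y, x * y \in E}.

(** As [E] is a vector space over the field with two elements, a subgroup [H]
    that misses [x] doubles in size when the coset [x + H] is added to it. *)
Lemma card_add_closed (E : {fset A}) :
  add_closed E -> 0 \in E -> exists k, #|` E| = (2 ^ k)%N.
Proof.
move=> E_add E0.
suff step d (H : {fset A}) a : add_closed H -> 0 \in H -> H `<=` E ->
    #|` H| = (2 ^ a)%N -> (#|` E| - #|` H| <= d)%N -> exists k, #|` E| = (2 ^ k)%N.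
  apply: (step _ [fset 0] 0%N _ _ _ _ (leqnn _)).
  - by move=> x y; rewrite !inE => /eqP -> /eqP ->; rewrite addr0.
  - by rewrite inE.
  - by rewrite fsub1set.
  - by rewrite cardfs1.
elim: d H a => [|d IHd] H a H_add H0 HE cardH le_d.
  have /eqP <- : H == E by rewrite eqEfcard HE; lia.
  by exists a.
have [EH|/fsubsetPn[x xE xH]] := boolP (E `<=` H).
  by exists a; have /eqP <- : H == E by rewrite eqEfsubset HE.
pose xH' := [fset x + h | h in H].
have xH'P y : (y \in xH') = (x + y \in H).
  apply/imfsetP/idP => [[h hH ->]|yH]; first by rewrite char2_cancel.
  by exists (x + y) => //; rewrite char2_cancel.
have disj : [disjoint H & xH']%fset.
  apply/fdisjointP => y yH; rewrite xH'P; apply: contra xH => /(H_add _ _ yH).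
  by rewrite addrC -addrA char2 addr0.
have card2 : #|` H `|` xH'| = (2 ^ a.+1)%N.
  rewrite cardfsU; move: disj; rewrite -fsetI_eq0 => /eqP ->.
  rewrite cardfs0 subn0 card_imfset /=; last exact: addrI.
  by rewrite cardH expnS mul2n addnn.
apply: (IHd (H `|` xH') a.+1) => //.
- move=> y z; rewrite !in_fsetU !xH'P => /orP[yH|yH] /orP[zH|zH].
  + by rewrite (H_add _ _ yH zH).
  + by rewrite addrCA (H_add _ _ yH zH) orbT.
  + by rewrite addrA (H_add _ _ yH zH) orbT.
  + by have := H_add _ _ yH zH; rewrite addrACA char2 add0r => ->.
- by rewrite in_fsetU H0.
- rewrite fsubUset HE; apply/fsubsetP => y; rewrite xH'P => /(fsubsetP HE) yE.
  by rewrite -(char2_cancel x y) E_add.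
- have : (0 < 2 ^ a)%N by rewrite expn_gt0.
  by move: le_d; rewrite card2 cardH expnS; lia.
Qed.

Lemma expr_closed (E : {fset A}) x i : mul_closed E -> x \in E ->
  x ^+ i.+1 \in E.
Proof.
by move=> E_mul xE; elim: i => [|i IHi]; rewrite ?expr1 // exprS E_mul.
Qed.

Lemma reduced_expr_eq0 (E : {fset A}) x i : mul_closed E ->
  {in E, forall x, x * x = 0 -> x = 0} -> x \in E -> x ^+ i = 0 -> x = 0.
Proof.
move=> E_mul E_red xE xi.
have pow2 j : x ^+ (2 ^ j) = 0 -> x = 0.
  elim: j => [|j IHj]; rewrite ?expn0 ?expr1 // expnS mul2n -addnn exprD.
  move=> /E_red x0; apply/IHj/x0.
  by rewrite -[(2 ^ j)%N]prednK ?expn_gt0 // expr_closed.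
apply: (pow2 i).
by rewrite -(subnKC (ltnW (ltn_expl i (isT : 1 < 2)%N))) exprD xi mul0r.
Qed.

(** By the pigeonhole principle the powers of [x] are eventually periodic; a
    power whose exponent is a multiple of the period and lies in the periodic
    range is idempotent. *)
Lemma exists_idempotent_power (E : {fset A}) x : mul_closed E -> x \in E ->
  exists m, x ^+ m.+1 \in E /\ x ^+ m.+1 * x ^+ m.+1 = x ^+ m.+1.
Proof.
move=> E_mul xE.
have powE i : x ^+ i.+1 \in E by exact: expr_closed.
have [i [p [p_gt0 xip]]] : exists i p, (0 < p)%N /\ x ^+ (i.+1 + p) = x ^+ i.+1.
  pose g (i : 'I_(#|` E|.+1)) : E := [` powE i].
  have /injectivePn[i [j ij /(congr1 val) /= eq_ij]] : ~~ injectiveb g.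
    apply/negP => /injectiveP /leq_card; rewrite card_ord -cardfE; lia.
  have [lt_ij|lt_ji|/val_inj eqij] := ltngtP i j.
  - by exists i, (j - i)%N; rewrite subn_gt0 addSn subnKC ?(ltnW lt_ij).
  - by exists j, (i - j)%N; rewrite subn_gt0 addSn subnKC ?(ltnW lt_ji).
  - by rewrite eqij eqxx in ij.
have per q j : x ^+ (i.+1 + j + q * p) = x ^+ (i.+1 + j).
  elim: q => [|q IHq]; first by rewrite addn0.
  have -> : (i.+1 + j + q.+1 * p = (i.+1 + p) + (j + q * p))%N by rewrite mulSn; lia.
  by rewrite exprD xip -exprD addnA.
exists (i.+1 * p).-1; rewrite prednK ?muln_gt0 //; split.
  by rewrite -[(_ * p)%N]prednK ?muln_gt0.
rewrite -exprD.
have -> : (i.+1 * p = i.+1 + (i.+1 * p - i.+1))%N by rewrite subnKC // leq_pmulr.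
by rewrite -[in X in _ = X](per i.+1); congr (_ ^+ _); rewrite subnKC // leq_pmulr.
Qed.

(** [e] is meant to be the identity element of [E], which need not be the one of
    the ambient ring: this is what lets the summands cut out of [E] by an
    idempotent be treated like [E] itself. *)
Definition invertibles (E : {fset A}) (e : A) : {fset A} :=
  [fset x in E | [exists y : E, x * val y == e]].

Lemma invertiblesP E e x :
  reflect (x \in E /\ exists2 y, y \in E & x * y = e) (x \in invertibles E e).
Proof.
rewrite !inE; apply: (iffP andP) => -[xE].
  by move=> /existsP[y /eqP xy]; split=> //; exists (val y) => //; exact: valP.
by move=> [y yE xy]; split=> //; apply/existsP; exists [` yE] => /=; apply/eqP.
Qed.

(** Peirce decomposition: the idempotent [f] splits [E] into the direct product of
    [f E], with identity [f], and [(e - f) E], with identity [e - f = e + f].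
    Addition is a bijection between pairs of invertible elements of the two
    factors and invertible elements of [E]. *)
Lemma card_invertibles_split (E : {fset A}) (e f : A) :
  add_closed E -> mul_closed E -> e \in E -> {in E, forall x, e * x = x} ->
  f \in E -> f * f = f ->
  #|` invertibles E e| =
    (#|` invertibles [fset x in E | (f * x)%R == x] f| *
     #|` invertibles [fset x in E | (f * x)%R == 0%R] (e + f)%R|)%N.
Proof.
move=> E_add E_mul eE e_id fE ff.
set U1 := invertibles _ f; set U2 := invertibles _ (e + f).
have ef : e * f = f by exact: e_id.
rewrite !cardfE -card_prod.
pose s (p : U1 * U2) : A := val p.1 + val p.2.
have fU1 x : x \in U1 -> f * x = x.
  by move=> /invertiblesP[]; rewrite !inE => /andP[_ /eqP].
have fU2 x : x \in U2 -> f * x = 0.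
  by move=> /invertiblesP[]; rewrite !inE => /andP[_ /eqP].
have s_inj : injective s.
  move=> [[a aU] [b bU]] [[a' a'U] [b' b'U]]; rewrite /s /= => eq_s.
  have eqa : a = a'.
    by have := congr1 ( *%R f) eq_s; rewrite !mulrDr (fU1 _ aU) (fU1 _ a'U)
      (fU2 _ bU) (fU2 _ b'U) !addr0.
  have eqb : b = b' by move: eq_s; rewrite eqa => /addrI.
  by congr (_, _); apply: val_inj.
have <- : #|` [fset s p | p in {: U1 * U2}]| = #|{: U1 * U2}|.
  by rewrite card_imfset //= -cardE.
rewrite -cardfE; congr #|` _|; apply/fsetP => x; apply/invertiblesP/imfsetP => [[xE [y yE xy]]|].
  have fx_in : f * x \in U1.
    apply/invertiblesP; rewrite !inE E_mul // mulrA ff eqxx; split=> //.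
    exists (f * y); first by rewrite !inE E_mul // mulrA ff eqxx.
    by rewrite mulrACA ff xy mulrC.
  have gx_in : x + f * x \in U2.
    have g_in z : z \in E -> z + f * z \in [fset x in E | f * x == 0].
      by move=> zE; rewrite !inE E_add ?E_mul // mulrDr mulrA ff char2 eqxx.
    apply/invertiblesP; split; first exact: g_in.
    exists (y + f * y); first exact: g_in.
    rewrite mulrDr !mulrDl [x * (f * y)]mulrCA mulrACA ff -mulrA xy [f * e]mulrC ef.
    by rewrite addrA -[_ + f + f]addrA char2 addr0.
  exists ([` fx_in], [` gx_in]) => //=.
  by rewrite /s /= addrCA char2 addr0.
move=> [[[a aU] [b bU]] _ ->]; rewrite /s /=.
have [] := invertiblesP _ _ _ aU; rewrite !inE => /andP[aE /eqP fa] [a'].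
rewrite !inE => /andP[a'E /eqP fa'] aa'.
have [] := invertiblesP _ _ _ bU; rewrite !inE => /andP[bE /eqP fb] [b'].
rewrite !inE => /andP[b'E /eqP fb'] bb'.
split; first exact: E_add.
exists (a' + b'); first exact: E_add.
have ab' : a * b' = 0 by rewrite -fa mulrAC fb' mul0r.
have ba' : b * a' = 0 by rewrite -fa' mulrCA mulrA fb mul0r.
rewrite mulrDr !mulrDl aa' bb' ab' ba'.
by rewrite addr0 add0r addrC -addrA char2 addr0.
Qed.

(** A finite reduced ring of characteristic 2 is a product of finite fields. If
    every nonzero element of [E] is invertible, then only 0 is removed from the
    [2 ^ k] elements of [E]. Otherwise the idempotent power [f] of a nonzero
    noninvertible [x] is neither 0, since [E] is reduced, nor the identity, and
    it splits [E] into two smaller rings. *)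
Lemma card_invertibles (E : {fset A}) (e : A) :
  add_closed E -> mul_closed E -> {in E, forall x, x * x = 0 -> x = 0} ->
  e \in E -> {in E, forall x, e * x = x} ->
  mersenne_product 2 #|` invertibles E e|.
Proof.
have [d] := ubnP #|` E|; elim: d => // d IHd in E e *.
move=> ltd E_add E_mul E_red eE e_id.
have E0 : 0 \in E by rewrite -(char2 e) E_add.
have [e0|e_neq0] := eqVneq e 0.
  have -> : invertibles E e = [fset 0].
    apply/fsetP => x; rewrite in_fset1; apply/invertiblesP/eqP => [[xE _]|->].
      by rewrite -(e_id x xE) e0 mul0r.
    by split=> //; exists 0; rewrite ?mulr0.
  by rewrite cardfs1; left.
have [EU|] := boolP (E `\ 0 `<=` invertibles E e).
  have -> : invertibles E e = E `\ 0.
    apply/eqP; rewrite eqEfsubset EU andbT; apply/fsubsetP => x.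
    move=> /invertiblesP[xE [y _ xy]]; rewrite in_fsetD1 xE andbT.
    by apply: contra_neq e_neq0 => x0; rewrite -xy x0 mul0r.
  have [k cardE] := card_add_closed E_add E0.
  have := cardfsD1 0 E; rewrite E0 cardE add1n => cardE0.
  have -> : #|` E `\ 0| = ((2 ^ k - 1) * 1)%N by rewrite cardE0 subn1 muln1.
  case: k cardE cardE0 => [|[|k]] cardE cardE0; last by right=> //; left.
    have : (#|` [fset 0%R; e]| <= #|` E|)%N.
      by apply/fsubset_leq_card/fsubsetP => x; rewrite !inE => /orP[]/eqP ->.
    by rewrite cardfs2 eq_sym e_neq0 cardE.
  by left.
move=> /fsubsetPn[x]; rewrite in_fsetD1 => /andP[x_neq0 xE] xU.
have [m [fE ff]] := exists_idempotent_power E_mul xE.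
set f := x ^+ m.+1 in fE ff.
have f_neq0 : f != 0.
  by apply: contra_neq x_neq0; exact: reduced_expr_eq0 E_mul E_red xE.
have f_neqe : f != e.
  apply: contraNneq xU => fe; apply/invertiblesP; split=> //.
  case: m @f fe {fE ff f_neq0} => [|m] /= fe.
    by exists e; rewrite // -fe expr1 -{1 2}[x]expr1 fe e_id.
  by exists (x ^+ m.+1); rewrite -?exprS // expr_closed.
rewrite (card_invertibles_split E_add E_mul eE e_id fE ff).
have sub_card (P : pred A) y : y \in E -> ~~ P y ->
    (#|` [fset x in E | P x]| < d)%N.
  move=> yE Py; move: ltd; rewrite (cardfsD1 y E) yE ltnS; apply: leq_trans.
  rewrite add1n ltnS; apply/fsubset_leq_card/fsubsetP => z.
  rewrite !inE => /andP[-> Pz]; rewrite andbT.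
  by apply: contraNneq Py => <-.
apply: mersenne_product_mul; apply: IHd.
- by apply: (sub_card _ e) => //; rewrite mulrC e_id // eq_sym.
- move=> y z; rewrite !inE => /andP[yE /eqP fy] /andP[zE /eqP fz].
  by rewrite E_add // mulrDr fy fz eqxx.
- move=> y z; rewrite !inE => /andP[yE /eqP fy] /andP[zE /eqP fz].
  by rewrite E_mul // mulrA fy eqxx.
- by move=> y; rewrite inE => /andP[yE _]; exact: E_red.
- by rewrite !inE fE ff eqxx.
- by move=> y; rewrite !inE => /andP[_ /eqP].
- by apply: (sub_card _ f) => //; rewrite ff.
- move=> y z; rewrite !inE => /andP[yE /eqP fy] /andP[zE /eqP fz].
  by rewrite E_add // mulrDr fy fz addr0 eqxx.
- move=> y z; rewrite !inE => /andP[yE /eqP fy] /andP[zE /eqP fz].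
  by rewrite E_mul // mulrA fy mul0r eqxx.
- by move=> y; rewrite inE => /andP[yE _]; exact: E_red.
- by rewrite !inE E_add // mulrDr ff mulrC e_id // char2 eqxx.
- by move=> y; rewrite !inE => /andP[yE /eqP fy]; rewrite mulrDl e_id // fy addr0.
Qed.
End FiniteSubring.

Section OddOrders.
Local Open Scope fset_scope.
Local Open Scope ring_scope.

(** A group of odd order has no element of order 2. Applied to [-1], this gives
    characteristic 2; applied to [1 + x] with [x * x = 0], it shows that [A] is
    reduced. The additive span of the units is then a finite subring of [A] with
    the same units. *)
Lemma odd_unit_group_order n : odd n -> unit_group_orders n -> mersenne_product 2 n.
Proof.
move=> n_odd [A Un].
have sqr1 u : u * u = 1 -> u = 1 :> A.
  move=> uu; apply: (odd_expr_sqr1 n_odd); rewrite ?expr2 //.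
  by apply: unit_expr_card Un _; exists u.
have char2 (x : A) : x + x = 0.
  have N1 : -1 = 1 :> A by apply: sqr1; rewrite mulrNN mulr1.
  by rewrite -[X in X + _]mul1r -N1 mulN1r addNr.
have reduced (x : A) : x * x = 0 -> x = 0.
  move=> xx; have : 1 + x = 1.
    by apply: sqr1; rewrite mulrDr mulr1 mulrDl mul1r xx addr0 -addrA char2 addr0.
  by rewrite -[RHS]addr0 => /addrI.
have Ufin : finite_set (units A) by apply/finite_setP; exists n.
pose U := fset_set (units A).
have UP x : reflect (units A x) (x \in U) by rewrite in_fset_set //; exact: asboolP.
(* In characteristic 2 all integral combinations of the units are subset sums. *)
pose comb (c : {ffun U -> bool}) : A := \sum_u val u *+ c u.
pose E := [fset comb c | c in {: {ffun U -> bool}}].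
have UE x : x \in U -> x \in E.
  move=> xU; apply/imfsetP; exists [ffun u => u == [` xU]] => //=.
  rewrite /comb (bigD1 [` xU]) //= ffunE eqxx big1 ?addr0 // => u u_neq.
  by rewrite ffunE (negPf u_neq).
have E_add : add_closed E.
  move=> _ _ /imfsetP[c _ ->] /imfsetP[c' _ ->].
  apply/imfsetP; exists [ffun u => c u (+) c' u] => //=.
  rewrite /comb -big_split; apply: eq_bigr => u _; rewrite ffunE.
  by case: (c u) (c' u) => -[] /=; rewrite ?addr0 ?add0r ?char2.
have E0 : 0 \in E.
  apply/imfsetP; exists [ffun=> false] => //=.
  by rewrite /comb big1 // => u _; rewrite ffunE.
have E_sum (I : finType) (F : I -> A) : (forall i, F i \in E) -> \sum_i F i \in E.
  by move=> FE; elim/big_rec: _ => // i x _; exact: E_add.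
have E_mul : mul_closed E.
  move=> _ _ /imfsetP[c _ ->] /imfsetP[c' _ ->].
  rewrite /comb mulr_suml; apply: (E_sum) => u.
  rewrite mulr_sumr; apply: (E_sum) => v.
  case: (c u); last by rewrite mul0r.
  case: (c' v); last by rewrite mulr0.
  rewrite !mulr1n UE //; apply/UP.
  have /UP[u' uu'] := valP u; have /UP[v' vv'] := valP v.
  by exists (u' * v'); rewrite mulrACA uu' vv' mulr1.
have E1 : 1 \in E by apply/UE/UP; exists 1; rewrite mulr1.
have -> : n = #|` invertibles E 1|.
  rewrite -(card_fset_set Un); congr #|` _|; apply/fsetP => x.
  apply/UP/invertiblesP => [[y xy]|[_ [y _ xy]]]; last by exists y.
  split; first by apply/UE/UP; exists y.
  by exists y => //; apply/UE/UP; exists x; rewrite mulrC.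
apply: card_invertibles => // [x _|x _]; first exact: reduced.
exact: mul1r.
Qed.

End OddOrders.

(** * Density *)

Section Density.
Local Open Scope classical_set_scope.
Local Open Scope ring_scope.

Lemma mem_initial_part (X : set nat) n k :
  (k \in fset_set (initial_part X n)) <-> X k /\ (1 <= k <= n)%N.
Proof.
rewrite in_fset_set; first by rewrite in_setE.
by apply: (@sub_finite_set _ _ `I_n.+1) => // i /= [_ /andP[]].
Qed.

Lemma card_initial_part_bounds (X : set nat) n L :
  (forall k, (0 < k)%N -> ~~ odd k -> X k) ->
  (forall k, odd k -> X k -> mersenne_product 2 k) ->
  (n < 4 ^ L)%N ->
  (n./2 <= #|` fset_set (initial_part X n)| <= n./2 + 3 ^ L.+1)%N.
Proof.
move=> Xeven Xodd ltn; pose evens := [seq k.+1.*2 | k <- iota 0 n./2].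
have evensP k : (k \in evens) = (0 < k)%N && (~~ odd k && (k <= n)%N).
  apply/mapP/idP => [[i + ->]|/and3P[k_gt0 k_even k_le]].
    by rewrite mem_iota => ?; apply/and3P; split; lia.
  by exists k./2.-1; rewrite ?mem_iota; lia.
have size_evens : size evens = n./2 by rewrite size_map size_iota.
apply/andP; split.
  rewrite -size_evens uniq_leq_size // => [|k].
    by rewrite map_inj_uniq ?iota_uniq // => i j; lia.
  rewrite evensP => /and3P[k_gt0 k_even k_le].
  by apply/mem_initial_part; rewrite k_gt0 k_le; split=> //; exact: Xeven.
apply: (@leq_trans (size (evens ++ mersenne_products_below L))).
  rewrite uniq_leq_size // => k /mem_initial_part[Xk /andP[k_gt0 k_le]].
  rewrite mem_cat evensP k_gt0 k_le andbT /=.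
  have [k_odd|//] := boolP (odd k).
  by apply: mem_mersenne_products_below; [exact: Xodd|exact: leq_ltn_trans ltn].
by rewrite size_cat size_evens leq_add2l size_mersenne_products_below.
Qed.

Lemma trunc_log_cvg_infty b : (1 < b)%N -> trunc_log b n @[n --> \oo] --> \oo.
Proof.
move=> b_gt1; apply/cvgnyPge => A.
exists (b ^ A)%N => // n /= ?; exact: trunc_log_max.
Qed.

(** The proportion [n./2 / n] of even numbers and the contribution [3 ^ l.+2 / n]
    of the odd ones are compared with [1 / 2] and [9 (3 / 4) ^ l] by means of
    [4 ^ l <= n]. *)
Lemma half_dist_bound (R : realType) (n c l : nat) :
  (4 ^ l <= n)%N -> (n./2 <= c <= n./2 + 3 ^ l.+2)%N ->
  `|c%:R / n%:R - 1 / 2 : R| <= 9 * (3 / 4) ^+ l.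
Proof.
move=> le_n c_bounds.
have n_gt0 : 0 < n%:R :> R by rewrite ltr0n (leq_trans _ le_n) ?expn_gt0.
have {}le_n : 4 ^+ l <= n%:R :> R by rewrite -natrX ler_nat.
have p3 : 1 <= 3 ^+ l :> R by rewrite exprn_ege1 // ler1n.
have [c_lo c_hi] : n%:R - 1 <= 2 * c%:R :> R /\ 2 * c%:R <= n%:R + 18 * 3 ^+ l :> R.
  rewrite -natrX -!natrM -natrD lerBlDr natr1 !ler_nat; move: c_bounds.
  by rewrite !expnS; lia.
rewrite ler_norml exprMn exprVn.
have : 9 * 3 ^+ l / n%:R <= 9 * (3 ^+ l / 4 ^+ l) :> R.
  rewrite -mulrA ler_pM2l // ler_pM2l ?(lt_le_trans _ p3) //.
  by rewrite lef_pV2 // posrE exprn_gt0.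
have : c%:R / n%:R <= 1 / 2 + 9 * 3 ^+ l / n%:R :> R.
  by rewrite ler_pdivrMr // mulrDl divfK ?gt_eqF //; lra.
have : 1 / 2 - 9 * 3 ^+ l / n%:R <= c%:R / n%:R :> R.
  by rewrite ler_pdivlMr // mulrBl divfK ?gt_eqF //; lra.
by move=> ? ? ?; apply/andP; split; lra.
Qed.

Lemma density_half (R : realType) (X : set nat) :
  (forall k, (0 < k)%N -> ~~ odd k -> X k) ->
  (forall k, odd k -> X k -> mersenne_product 2 k) ->
  has_density X (1 / 2 : R).
Proof.
move=> Xeven Xodd; rewrite /has_density.
apply/subr_cvg0/norm_cvg0P.
pose B (l : nat) : R := 9 * (3 / 4) ^+ l.
apply: (@squeeze_cvgr _ _ _ _ (fun=> 0) (fun n => B (trunc_log 4 n))).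
- exists 1%N => // n /= n_gt0; rewrite normr_ge0 /=.
  apply: half_dist_bound; first exact: trunc_logP.
  by apply: card_initial_part_bounds => //; exact: trunc_log_ltn.
- exact: cvg_cst.
- have cvgB : B l @[l --> \oo] --> (9 * 0 : R).
    by apply: cvgMr; apply: cvg_expr; rewrite ger0_norm; lra.
  rewrite mulr0 in cvgB.
  exact: (cvg_comp _ B (trunc_log_cvg_infty (isT : (1 < 4)%N)) cvgB).
Qed.

End Density.

Theorem propositionA2 (R : realType) :
  has_density unit_group_orders (1 / 2 : R).
Proof.
apply: density_half => k; first exact: even_unit_group_order.
exact: odd_unit_group_order.
Qed.
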